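(* If a finite simple graph $G$ admits a split divide, then there is a composable pair $(G_1,G_2)$ such that $G$ is the split unification of $(G_1,G_2)$, where each of $G_1$ and $G_2$ has strictly fewer vertices than $G$ and is isomorphic to an induced subgraph of $G$.
   Context: For $S\subseteq V(G)$ and $v\notin S$: $v$ is complete to $S$ if adjacent to all of $S$, anticomplete if adjacent to none, mixed on $S$ otherwise; a set is complete (anticomplete) to a disjoint set if each of its vertices is. An anticomponent of $S$ is a subset of $S$ inducing a connected component of the complement of $G[S]$. A split divide of $G$ is a partition $(A,B,C,L,T)$ of $V(G)$ (where $B,T$ may be empty) such that: $|A|\ge 2$, $A$ is complete to $B$ and anticomplete to $C\cup T$, and some vertex of $A$ is complete to $L$; $L$ is a non-empty clique, every vertex of $L$ is mixed on $A$, and $L$ is complete to $B\cup C$; $|C|\ge 2$, some vertex of $C$ is complete to $B$, and no vertex of $C$ is mixed on any anticomponent of $B$; $T$ is a (possibly empty) stable set anticomplete to $C$. Composable pair: let $A,B,C,L,T$ be pairwise disjoint sets with $A,C$ non-empty, and $a^*,c^*$ two distinct vertices not in $A\cup B\cup C\cup L\cup T$. $G_1$ is a graph on $A\cup B\cup L\cup T\cup\{c^*\}$ such that $L$ is a (possibly empty) clique, $T$ is a (possibly empty) stable set, $A$ is complete to $B$ and anticomplete to $T$, some vertex of $A$ is complete to $L$, and $c^*$ is complete to $B\cup L$ and anticomplete to $A\cup T$ (other adjacencies arbitrary). $G_2$ is a graph on $B\cup C\cup L\cup T\cup\{a^*\}$ such that $G_2[B\cup L\cup T]=G_1[B\cup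 L\cup T]$, $T$ is anticomplete to $C$, $L$ is complete to $B\cup C$, $a^*$ is complete to $B\cup L$ and anticomplete to $C\cup T$, some vertex of $C$ is complete to $B$, and no vertex of $C$ is mixed on any anticomponent of $B$ (other adjacencies arbitrary). Then $(G_1,G_2)$ is a composable pair. Its split unification is the graph $G$ on $A\cup B\cup C\cup L\cup T$ with $G[A\cup B\cup L\cup T]=G_1\setminus c^*$, $G[B\cup C\cup L\cup T]=G_2\setminus a^*$, and $A$ anticomplete to $C$. *)

(* Defs.v *)
From mathcomp Require Import all_boot finmap.

Set Implicit Arguments.
Unset Strict Implicit.
Unset Printing Implicit Defensive.

Local Open Scope fset_scope.

(* Finite simple graphs whose vertices are drawn from a universe K, so that
   several graphs can share vertices. *)
Record graph (K : choiceType) := Graph {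
  vset : {fset K};
  adj : rel K;
  adj_sym : symmetric adj;
  adj_irr : irreflexive adj;
  adj_vset : forall x y, adj x y -> (x \in vset) && (y \in vset)
}.

(* Guarantees that the vertices a^* and c^*, which lie outside the given finite
   vertex sets, exist. *)
Definition infinite_universe (K : choiceType) : Prop :=
  forall X : {fset K}, exists x, x \notin X.

Section Graphs.
Variable K : choiceType.
Implicit Types (G H : graph K) (S X Y A B C L T : {fset K}) (v : K).

Definition same_graph G H : Prop := vset G = vset H /\ adj G =2 adj H.

Definition induced_adj G S : rel K :=
  [rel x y | [&& x \in S, y \in S & adj G x y]].

Lemma induced_sym G S : symmetric (induced_adj G S).
Proof. by move=> x y; rewrite /induced_adj /= adj_sym andbCA. Qed.

Lemma induced_irr G S : irreflexive (induced_adj G S).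
Proof. by move=> x; rewrite /induced_adj /= adj_irr !andbF. Qed.

Lemma induced_vset G S x y : induced_adj G S x y ->
  (x \in vset G `&` S) && (y \in vset G `&` S).
Proof.
by move=> /and3P[xS yS /adj_vset/andP[xG yG]]; rewrite !inE xS yS xG yG.
Qed.

Definition induced G S : graph K :=
  Graph (@induced_sym G S) (@induced_irr G S) (@induced_vset G S).

Definition del_vertex G v : graph K := induced G (vset G `\ v).

Definition compl_adj G : rel K :=
  [rel x y | [&& x \in vset G, y \in vset G, x != y & ~~ adj G x y]].

Lemma compl_sym G : symmetric (compl_adj G).
Proof. by move=> x y; rewrite /compl_adj /= adj_sym eq_sym andbCA. Qed.

Lemma compl_irr G : irreflexive (compl_adj G).
Proof. by move=> x; rewrite /compl_adj /= eqxx !andbF. Qed.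

Lemma compl_vset G x y : compl_adj G x y -> (x \in vset G) && (y \in vset G).
Proof. by move=> /and4P[-> ->]. Qed.

Definition complement G : graph K :=
  Graph (@compl_sym G) (@compl_irr G) (@compl_vset G).

Definition component G S : Prop :=
  exists x : vset G,
    S = [fset val y | y : vset G
         & connect [rel u v : vset G | adj G (val u) (val v)] x y].

Definition anticomponent G X S : Prop := component (complement (induced G X)) S.

(* Only meaningful for v \notin S. *)
Definition complete G v S : Prop := {in S, forall x, adj G v x}.
Definition anticomplete G v S : Prop := {in S, forall x, ~~ adj G v x}.
Definition mixed G v S : Prop := ~ complete G v S /\ ~ anticomplete G v S.

Definition set_complete G X Y : Prop := {in X, forall x, complete G x Y}.
Definition set_anticomplete G X Y : Prop := {in X, forall x, anticomplete G x Y}.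

Definition clique G X : Prop := {in X &, forall x y, x != y -> adj G x y}.
Definition stable G X : Prop := {in X &, forall x y, ~~ adj G x y}.

Definition isomorphic G H : Prop :=
  exists f : K -> K,
    [/\ {in vset G &, injective f},
        f @` vset G = vset H
      & {in vset G &, forall x y, adj H (f x) (f y) = adj G x y}].

Definition iso_to_induced_subgraph H G : Prop :=
  exists2 S, S `<=` vset G & isomorphic H (induced G S).

Record split_divide G A B C L T : Prop := SplitDivide {
  sd_disjoint : pairwise fdisjoint [:: A; B; C; L; T];
  sd_cover : vset G = A `|` B `|` C `|` L `|` T;
  sd_A_card : 2 <= #|` A|;
  sd_A_B : set_complete G A B;
  sd_A_CT : set_anticomplete G A (C `|` T);
  sd_A_L : exists2 v, v \in A & complete G v L;
  sd_L_neq0 : L != fset0;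
  sd_L_clique : clique G L;
  sd_L_A : {in L, forall v, mixed G v A};
  sd_L_BC : set_complete G L (B `|` C);
  sd_C_card : 2 <= #|` C|;
  sd_C_B : exists2 v, v \in C & complete G v B;
  sd_C_mixed : {in C, forall v S, anticomponent G B S -> ~ mixed G v S};
  sd_T_stable : stable G T;
  sd_T_C : set_anticomplete G T C
}.

Record composable_pair A B C L T (astar cstar : K) (G1 G2 : graph K) : Prop :=
  ComposablePair {
  cp_disjoint : pairwise fdisjoint [:: A; B; C; L; T];
  cp_A_neq0 : A != fset0;
  cp_C_neq0 : C != fset0;
  cp_star_neq : astar != cstar;
  cp_astar : astar \notin A `|` B `|` C `|` L `|` T;
  cp_cstar : cstar \notin A `|` B `|` C `|` L `|` T;
  cp1_vset : vset G1 = cstar |` (A `|` B `|` L `|` T);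
  cp1_L : clique G1 L;
  cp1_T : stable G1 T;
  cp1_A_B : set_complete G1 A B;
  cp1_A_T : set_anticomplete G1 A T;
  cp1_A_L : exists2 v, v \in A & complete G1 v L;
  cp1_cstar_BL : complete G1 cstar (B `|` L);
  cp1_cstar_AT : anticomplete G1 cstar (A `|` T);
  cp2_vset : vset G2 = astar |` (B `|` C `|` L `|` T);
  cp2_BLT : same_graph (induced G2 (B `|` L `|` T)) (induced G1 (B `|` L `|` T));
  cp2_T_C : set_anticomplete G2 T C;
  cp2_L_BC : set_complete G2 L (B `|` C);
  cp2_astar_BL : complete G2 astar (B `|` L);
  cp2_astar_CT : anticomplete G2 astar (C `|` T);
  cp2_C_B : exists2 v, v \in C & complete G2 v B;
  cp2_C_mixed : {in C, forall v S, anticomponent G2 B S -> ~ mixed G2 v S}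
}.

Record split_unification A B C L T (astar cstar : K) (G1 G2 G : graph K) : Prop :=
  SplitUnification {
  su_vset : vset G = A `|` B `|` C `|` L `|` T;
  su_G1 : same_graph (induced G (A `|` B `|` L `|` T)) (del_vertex G1 cstar);
  su_G2 : same_graph (induced G (B `|` C `|` L `|` T)) (del_vertex G2 astar);
  su_A_C : set_anticomplete G A C
}.

End Graphs.

(* Main.v *)
Require Import Defs.
From mathcomp Require Import all_boot finmap.

Set Implicit Arguments.
Unset Strict Implicit.
Unset Printing Implicit Defensive.

Local Open Scope fset_scope.

(** Choose [a0] in [A] complete to [L] and [c0] in [C] complete to [B].  Both are
    then complete to [B] and [L]; moreover [a0] is anticomplete to [C] and [T],
    and [c0] to [A] and [T].  Hence [G1] can be taken to be the subgraph of [G]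
    induced on [A], [B], [L], [T] and [c0], with [c0] renamed [c^*]; symmetrically
    [G2] is the subgraph induced on [B], [C], [L], [T] and [a0], with [a0] renamed
    [a^*].  Both are smaller than [G] because [C] and [A] have at least two
    vertices. *)

Section Rename.
Variable K : choiceType.
Implicit Types (G H : graph K) (S X Y : {fset K}) (v w x y : K).

Lemma same_graph_sym G H : same_graph G H -> same_graph H G.
Proof. by move=> [eqV eqA]; split=> // x y; rewrite eqA. Qed.

Lemma same_graph_trans G H I : same_graph G H -> same_graph H I -> same_graph G I.
Proof. by move=> [eqV eqA] [eqV' eqA']; split=> [|x y]; rewrite ?eqV ?eqA. Qed.

Lemma same_graph_complement G H :
  same_graph G H -> same_graph (complement G) (complement H).
Proof. by move=> [eqV eqA]; split=> // x y; rewrite /= /compl_adj /= eqV eqA. Qed.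

Lemma same_graph_component G H S :
  same_graph G H -> component G S -> component H S.
Proof.
case: G => V a sa ia va; case: H => W b sb ib vb [/= eqV eqA].
(* [component] quantifies over the subtype of the vertex set, so the two vertex sets must be
   identified before [connect] can be compared on a common type. *)
case: W / eqV vb => vb [x /= ->]; exists x => /=.
have eqc : connect [rel u v : V | a (val u) (val v)] =2
           connect [rel u v : V | b (val u) (val v)].
  by apply: eq_connect => u v /=; rewrite eqA.
apply/fsetP=> z; apply/imfsetP/imfsetP => -[y yP ->]; exists y => //;
  by move: yP; rewrite !inE eqc.
Qed.

Lemma component_sub G S : component G S -> S `<=` vset G.
Proof. by case=> x ->; apply/fsubsetP => _ /imfsetP[y _ ->]; apply: valP. Qed.

Lemma anticomponent_sub G X S : anticomponent G X S -> S `<=` X.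
Proof. by move/component_sub=> /fsubset_trans; apply; apply: fsubsetIr. Qed.

(** The map runs from new names to old ones: adjacency after renaming is a pullback along it, so
    symmetry and irreflexivity are inherited. *)
Definition rename w v x := if x == v then w else x.

Definition rename_adj G S w v : rel K :=
  [rel x y | [&& x \in v |` S, y \in v |` S & adj G (rename w v x) (rename w v y)]].

Lemma rename_sym G S w v : symmetric (rename_adj G S w v).
Proof. by move=> x y; rewrite /rename_adj /= adj_sym andbCA. Qed.

Lemma rename_irr G S w v : irreflexive (rename_adj G S w v).
Proof. by move=> x; rewrite /rename_adj /= adj_irr !andbF. Qed.

Lemma rename_vset G S w v x y :
  rename_adj G S w v x y -> (x \in v |` S) && (y \in v |` S).
Proof. by move=> /and3P[-> ->]. Qed.

(* The subgraph of [G] induced on [w |` S], with [w] renamed [v]. *)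
Definition rename_graph G S w v : graph K :=
  Graph (@rename_sym G S w v) (@rename_irr G S w v) (@rename_vset G S w v).

Section RenameTheory.
Variables (G : graph K) (S : {fset K}) (w v : K).
Hypotheses (sSG : S `<=` vset G) (vS : v \notin S).

Let H := rename_graph G S w v.

Lemma rename_id x : x \in S -> rename w v x = x.
Proof. by move=> xS; rewrite /rename; case: eqP xS vS => // -> ->. Qed.

Lemma adj_rename : {in S &, adj H =2 adj G}.
Proof. by move=> x y xS yS; rewrite /= /rename_adj /= !inE xS yS !orbT !rename_id. Qed.

Lemma adj_rename_new : {in S, adj H v =1 adj G w}.
Proof.
move=> x xS; rewrite /= /rename_adj /= !inE eqxx xS orbT (rename_id xS).
by rewrite /rename eqxx.
Qed.

(** Since [v] is not in [S], the renaming fixes every vertex of [X]. *)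
Lemma induced_rename X : X `<=` S -> same_graph (induced H X) (induced G X).
Proof.
move=> sXS; split=> [|x y] /=.
  rewrite (fsetIidPr _) ?(fsetIidPr (fsubset_trans sXS sSG)) //.
  exact: fsubset_trans sXS (fsubsetUr _ _).
rewrite /induced_adj /=; case: (boolP (x \in X)) => // xX.
by case: (boolP (y \in X)) => // yX; rewrite -adj_rename ?(fsubsetP sXS).
Qed.

Lemma del_vertex_rename : same_graph (induced G S) (del_vertex H v).
Proof.
by rewrite /del_vertex /= fsetU1K //; apply/same_graph_sym/induced_rename.
Qed.

(** Anticomponents of [X] depend only on the subgraph induced on [X], which the renaming
    preserves. *)
Lemma anticomponent_rename X Y :
  X `<=` S -> anticomponent H X Y -> anticomponent G X Y.
Proof. by move/induced_rename/same_graph_complement/same_graph_component; apply. Qed.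

Lemma rename_iso : w \in vset G -> w \notin S -> iso_to_induced_subgraph H G.
Proof.
move=> wG wS; have sG : w |` S `<=` vset G by rewrite fsubUset fsub1set wG.
have renameS x : x \in v |` S -> rename w v x \in w |` S.
  by rewrite !inE /rename; case: eqP => [_|_ /= ->]; rewrite ?eqxx ?orbT.
exists (w |` S) => //; exists (rename w v); split=> /=.
(* Injectivity could fail only between [v] and the vertex [w] of [S], and [wS] excludes the
   latter. *)
- move=> x y; rewrite !inE /rename.
  case: eqP => [->|_]; case: eqP => [-> //|_] //=.
    by move=> _ yS Ew; rewrite -Ew (negPf wS) in yS.
  by move=> xS _ Ew; rewrite Ew (negPf wS) in xS.
- rewrite (fsetIidPr sG); apply/fsetP=> z; apply/imfsetP/idP => [[x xS ->]|].
    exact: renameS.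
  rewrite !inE => /orP[/eqP->|zS]; last by exists z; rewrite ?rename_id // !inE zS orbT.
  by exists v; rewrite ?inE /rename ?eqxx.
- by move=> x y xS yS; rewrite /induced_adj /rename_adj /= !renameS // xS yS.
Qed.

(** The single vertex [v] replaces all of [X]: [H] has one vertex more than [S], while [G] has at
    least two more. *)
Lemma card_rename X : X `<=` vset G -> [disjoint S & X] -> 2 <= #|` X| ->
  #|` vset H| < #|` vset G|.
Proof.
move=> sXG dSX X2; rewrite /= cardfsU1 vS /=.
have : #|` S `|` X| <= #|` vset G| by rewrite fsubset_leq_card // fsubUset sSG.
rewrite cardfsU (disjoint_fsetI0 dSX) cardfs0 subn0; apply: leq_trans.
by rewrite addnC -addnS leq_add2l.
Qed.

End RenameTheory.
End Rename.

Theorem theorem4p1 (K : choiceType) (G : graph K) :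
  infinite_universe K ->
  (exists A B C L T : {fset K}, split_divide G A B C L T) ->
  exists (A B C L T : {fset K}) (astar cstar : K) (G1 G2 : graph K),
    [/\ composable_pair A B C L T astar cstar G1 G2,
        split_unification A B C L T astar cstar G1 G2 G,
        (#|` vset G1| < #|` vset G|)%N /\ (#|` vset G2| < #|` vset G|)%N,
        iso_to_induced_subgraph G1 G
      & iso_to_induced_subgraph G2 G].
Proof.
move=> infK [A [B [C [L [T]]]]] [dis cov A2 AB ACT [a0 a0A a0L] _ Lcl _ LBC C2
  [c0 c0C c0B] Cmix Tst TC].
have [astar astarG] := infK (vset G).
have [cstar] := infK (astar |` vset G).
rewrite !inE negb_or => /andP[star_neq cstarG].
pose S1 := A `|` B `|` L `|` T; pose S2 := B `|` C `|` L `|` T.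
have sub1 : S1 `<=` vset G.
  by apply/fsubsetP => x; rewrite cov !inE => /orP[/orP[/orP[]|]|] ->; rewrite ?orbT.
have sub2 : S2 `<=` vset G.
  by apply/fsubsetP => x; rewrite cov !inE => /orP[/orP[/orP[]|]|] ->; rewrite ?orbT.
have cS1 : cstar \notin S1 by apply: contraNN cstarG; apply: (fsubsetP sub1).
have aS2 : astar \notin S2 by apply: contraNN astarG; apply: (fsubsetP sub2).
have sCG : C `<=` vset G.
  by apply/fsubsetP => x; rewrite cov !inE => ->; rewrite ?orbT.
have sAG : A `<=` vset G.
  by apply/fsubsetP => x; rewrite cov !inE => ->; rewrite ?orbT.
(* Used twice: [c0] and [a0] lie outside [S1] and [S2], as the isomorphisms require, and the vertex
   counts are strict. *)
have [dS1C dS2A] : [disjoint S1 & C] /\ [disjoint S2 & A].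
  move: dis => /= /and5P[/and5P[dAB dAC dAL dAT _] /and4P[dBC _ _ _]
    /and3P[dCL dCT _] _ _].
  rewrite !fdisjointUX dAC dBC (fdisjoint_sym L C) dCL (fdisjoint_sym T C) dCT.
  by rewrite !(fdisjoint_sym _ A) dAB dAC dAL dAT.
have c0S1 : c0 \notin S1.
  by apply/negP => /(fdisjointP dS1C); rewrite c0C.
have a0S2 : a0 \notin S2.
  by apply/negP => /(fdisjointP dS2A); rewrite a0A.
have [A1 B1 L1 T1] : [/\ A `<=` S1, B `<=` S1, L `<=` S1 & T `<=` S1].
  by split; apply/fsubsetP => x; rewrite !inE => ->; rewrite ?orbT.
have [B2 C2' L2 T2] : [/\ B `<=` S2, C `<=` S2, L `<=` S2 & T `<=` S2].
  by split; apply/fsubsetP => x; rewrite !inE => ->; rewrite ?orbT.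
pose G1 := rename_graph G S1 c0 cstar; pose G2 := rename_graph G S2 a0 astar.
have adj1 : {in S1 &, adj G1 =2 adj G} by apply: adj_rename.
have adj2 : {in S2 &, adj G2 =2 adj G} by apply: adj_rename.
have adjc : {in S1, adj G1 cstar =1 adj G c0} by apply: adj_rename_new.
have adja : {in S2, adj G2 astar =1 adj G a0} by apply: adj_rename_new.
exists A, B, C, L, T, astar, cstar, G1, G2; split.
- split=> //.
  + by rewrite -cardfs_gt0 ltnW.
  + by rewrite -cardfs_gt0 ltnW.
  + by rewrite eq_sym.
  + by rewrite -cov.
  + by rewrite -cov.
  + by move=> x y xL yL; rewrite adj1 ?(fsubsetP L1) //; apply: Lcl.
  + by move=> x y xT yT; rewrite adj1 ?(fsubsetP T1) //; apply: Tst.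
  + move=> x xA y yB; rewrite adj1 ?(fsubsetP A1 x) ?(fsubsetP B1 y) //.
    exact: AB.
  + move=> x xA y yT; rewrite adj1 ?(fsubsetP A1 x) ?(fsubsetP T1 y) //.
    by apply: ACT; rewrite // inE yT orbT.
  + exists a0 => // y yL; rewrite adj1 ?(fsubsetP A1 a0) ?(fsubsetP L1 y) //.
    exact: a0L.
  (* [cstar] has the adjacencies of [c0]: to [B] by the choice of [c0], to [L] because [L] is
     complete to [C]. *)
  + move=> y; rewrite inE => /orP[yB|yL].
      by rewrite adjc ?(fsubsetP B1) //; apply: c0B.
    rewrite adjc ?(fsubsetP L1) // adj_sym.
    by apply: LBC; rewrite // inE c0C orbT.
  + move=> y; rewrite inE => /orP[yA|yT].
      rewrite adjc ?(fsubsetP A1) // adj_sym.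
      by apply: ACT; rewrite // inE c0C.
    by rewrite adjc ?(fsubsetP T1) // adj_sym; apply: TC.
  (* This set lies in both [S1] and [S2], so each side agrees with [G] on it. *)
  + apply: (@same_graph_trans _ _ (induced G (B `|` L `|` T))).
      by apply: induced_rename; rewrite // !fsubUset B2 L2 T2.
    by apply/same_graph_sym/induced_rename; rewrite // !fsubUset B1 L1 T1.
  + move=> x xT y yC; rewrite adj2 ?(fsubsetP T2 x) ?(fsubsetP C2' y) //.
    exact: TC.
  + move=> x xL y yBC; rewrite adj2 ?(fsubsetP L2 x) //; first exact: LBC.
    by move: yBC; rewrite inE => /orP[/(fsubsetP B2)|/(fsubsetP C2')].
  + move=> y; rewrite inE => /orP[yB|yL].
      by rewrite adja ?(fsubsetP B2) //; apply: AB.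
    by rewrite adja ?(fsubsetP L2) //; apply: a0L.
  + move=> y yCT; rewrite adja; first exact: ACT.
    by move: yCT; rewrite inE => /orP[/(fsubsetP C2')|/(fsubsetP T2)].
  + exists c0 => // y yB; rewrite adj2 ?(fsubsetP C2' c0) ?(fsubsetP B2 y) //.
    exact: c0B.
  (* As [B] and [C] lie in [S2], [Y] is also an anticomponent of [B] in [G], and [v] has the same
     neighbours in [Y]; so being mixed on [Y] would contradict [Cmix]. *)
  + move=> v vC Y antiY [ncY naY]; have sYB := anticomponent_sub antiY.
    have eqY y : y \in Y -> adj G2 v y = adj G v y.
      by move=> /(fsubsetP sYB) yB; rewrite adj2 ?(fsubsetP C2' v) ?(fsubsetP B2 y).
    apply: (Cmix v vC Y); first exact: anticomponent_rename antiY.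
    by split=> cY; [apply: ncY | apply: naY] => y yY; rewrite eqY //; apply: cY.
- split=> //.
  + exact: del_vertex_rename.
  + exact: del_vertex_rename.
  + by move=> x xA y yC; apply: ACT; rewrite // inE yC.
- by split; [apply: card_rename C2 | apply: card_rename A2].
- by apply: rename_iso; rewrite // (fsubsetP sCG).
- by apply: rename_iso; rewrite // (fsubsetP sAG).
Qed.
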